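(* Suppose that the mesh bound $|\mathcal O|\le\frac{m(\Omega)}{\alpha}h^{-\ell}$ holds and that the numerical fluxes are monotone, conservative, regular and consistent, as described in the context. Assume that $u_0$ takes values in $[0,u_{\max}]$. Then the approximate solution $u_{\mathcal O,\delta t}$ of problem $(P)$ defined by the implicit finite volume scheme described in the context satisfies $$0\le u_K^n\le u_{\max}\qquad\text{for all }K\in\mathcal O\text{ and all }n.$$
   Context: Data. Let $\ell\ge1$, $\Omega\subset\mathbb R^\ell$ a bounded open set with Lipschitz boundary, $\eta$ the outward unit normal to $\partial\Omega$, $T>0$, $Q=(0,T)\times\Omega$, $u_{\max}>0$. The $\mathbb R^\ell$-valued function $f$ is continuous with $f(0)=f(u_{\max})=0$. The function $\phi$ is nondecreasing and Lipschitz continuous in $[0,u_{\max}]$, and for some $u_c\in[0,u_{\max}]$, $\phi\equiv0$ on $[0,u_c]$ and $\phi$ is strictly increasing on $[u_c,u_{\max}]$. The couple $(f,\phi)$ is non-degenerate: for every $\xi\in\mathbb R^\ell\setminus\{0\}$ the function $\lambda\mapsto\sum_i\xi_if_i(\lambda)$ is not affine on the non-degenerate subintervals of $[0,u_c]$. Problem $(P)$: $u_t+\operatorname{div}f(u)-\Delta\phi(u)=0$ in $Q$, $u(0,\cdot)=u_0$ in $\Omega$, $(f(u)-\nabla\phi(u))\cdot\eta=0$ on $(0,T)\times\partial\Omega$. Mesh. $\mathcal O$ is a family of disjoint connected polygonal control volumes $K\subset\Omega$ whose closures have union $\overline\Omega$, the common interface of two control volumes being included in a hyperplane; $h=\sup_K\operatorname{diam}K$.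 There is $\alpha>0$ with $\alpha h^\ell\le m(K)$ and $m(\partial K)\le\frac1\alpha h^{\ell-1}$ for all $K$, which gives $|\mathcal O|\le\frac{m(\Omega)}{\alpha}h^{-\ell}$ for the number $|\mathcal O|$ of control volumes; $m$ denotes $\ell$- or $(\ell-1)$-dimensional measure. $\mathcal N(K)$ is the set of neighbours of $K$; $K|L$ is the common edge of $K$ and $L\in\mathcal N(K)$; $\bar\varepsilon_K$ is the set of all edges of $K$ (including those on $\partial\Omega$); $n_{K,\sigma}$ is the unit normal to $\sigma$ outward to $K$. The mesh is admissible: there are points $x_K\in K$ such that the line $x_Kx_L$ is orthogonal to $K|L$; $d_{K,L}=|x_K-x_L|$, $\tau_{K|L}=m(K|L)/d_{K,L}$. Numerical fluxes. For $K\in\mathcal O$, $\sigma\in\bar\varepsilon_K$, the flux $F_{K,\sigma}:\mathbb R^2\to\mathbb R$ (written $F_{K,L}$ if $\sigma=K|L$) satisfies, for arguments in $[0,u_{\max}]$: (monotone) $F_{K,\sigma}(a,b)$ is nondecreasing in $a$ and nonincreasing in $b$; (conservative) $F_{K,L}(a,b)=-F_{L,K}(b,a)$; (regular) $F_{K,\sigma}$ is Lipschitz continuous with Lipschitz constant $m(\sigma)M$; (consistent) $F_{K,\sigma}(s,s)=m(\sigma)f(s)\cdot n_{K,\sigma}$. Scheme. With time step $\delta t>0$: $u_K^0=\frac1{m(K)}\int_Ku_0\,dx$, and for all $n\ge0$, $K\in\mathcal O$, $$m(K)\frac{u_K^{n+1}-u_K^n}{\delta t}+\sum_{L\in\mathcal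 N(K)}F_{K,L}(u_K^{n+1},u_L^{n+1})-\sum_{L\in\mathcal N(K)}\tau_{K|L}\big(\phi(u_L^{n+1})-\phi(u_K^{n+1})\big)=0$$ (fluxes through boundary edges are zero). If the scheme has a solution, the function $u_{\mathcal O,\delta t}(t,x)=u_K^{n+1}$ for $x\in K$, $t\in(n\delta t,(n+1)\delta t]$ is called an approximate solution of $(P)$.
   Formalization: The fluxes F_{K,L} are also assumed monotone and conservative for all real arguments and φ nondecreasing on all of R, not only on [0,u_max]; with arbitrary values outside [0,u_max] a solution of the scheme can leave that interval. *)

(* Defs.v *)
From HB Require Import structures.
From mathcomp Require Import all_boot all_order all_algebra.
From mathcomp Require Import all_classical all_reals all_analysis.

Set Implicit Arguments.
Unset Strict Implicit.
Unset Printing Implicit Defensive.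

Import Order.TTheory GRing.Theory Num.Theory.
Import numFieldNormedType.Exports.

Local Open Scope classical_set_scope.
Local Open Scope ring_scope.

(* The norm that MathComp-Analysis puts on 'rV[R]_l is the max norm.  It induces
   the usual topology (used for closure, interior, connected, bounded_set), but
   lengths, diameters and normals are Euclidean: they go through [enorm]. *)
Section EuclideanSpace.
Context {R : realType} {l : nat}.
Implicit Types (x y a b : 'rV[R]_l) (A B : set 'rV[R]_l).

Definition dotp x y : R := \sum_i x 0 i * y 0 i.

Definition enorm x : R := Num.sqrt (dotp x x).

Definition ediam A : \bar R :=
  ereal_sup [set (enorm (p.1 - p.2))%:E | p in A `*` A].

Definition boundary A : set 'rV[R]_l := closure A `\` A°.

Definition in_hyperplane A : Prop :=
  exists (a : 'rV[R]_l) (c : R), a != 0 /\ forall x, A x -> dotp a x = c.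

Definition polytope A : Prop :=
  bounded_set A /\
  exists s : seq ('rV[R]_l * R),
    A = [set x | forall ab, ab \in s -> dotp ab.1 x <= ab.2].

Definition polygonal A : Prop :=
  exists (n : nat) (P : 'I_n -> set 'rV[R]_l),
    (forall i, polytope (P i)) /\ A = (\bigcup_i P i)°.

(* Near each of its boundary points, A is the strict epigraph, in some direction
   e, of a Lipschitz function of the coordinates orthogonal to e. *)
Definition lipschitz_boundary A : Prop :=
  forall x, boundary A x ->
  exists (r k : R) (e : 'rV[R]_l) (g : 'rV[R]_l -> R),
    [/\ 0 < r,
        enorm e = 1,
        forall y z, `|g y - g z| <= k * enorm (y - z),
        forall y t, g (y + t *: e) = g y
      & forall y, enorm (y - x) < r -> (A y <-> g y < dotp y e)].

End EuclideanSpace.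

(* Both measures below are obtained from [mu_ext], i.e. as the infimum of
   \sum_k w (A k) over the countable covers (A k) of a set.  The covers are made
   of arbitrary sets, hence the discrete sigma-algebra; the set function w
   decides what a piece of a cover costs. *)
Definition discrete_type (T : pointedType) := g_sigma_algebraType [set: set T].

Section Measures.
Context {R : realType}.
Local Open Scope ereal_scope.

Definition closed_box {l} (a b : 'rV[R]_l) : set 'rV[R]_l :=
  [set x | forall i, (a 0 i <= x 0 i <= b 0 i)%R].

(* The empty set is singled out because of the dimension l = 0, where every box
   is the whole space and has volume 1. *)
Definition box_cost {l} (A : set 'rV[R]_l) : \bar R :=
  if A == set0 then 0 else
  ereal_inf [set (\prod_i (ab.2 0 i - ab.1 0 i)%R)%:E | ab in
    [set ab : 'rV[R]_l * 'rV[R]_l |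
      (forall i, (ab.1 0 i <= ab.2 0 i)%R) /\ A `<=` closed_box ab.1 ab.2]].

Definition lebesgue_rV {l : nat} : set 'rV[R]_l -> \bar R :=
  @mu_ext _ (discrete_type 'rV[R]_l) R box_cost.

Lemma box_cost0 l : @box_cost l set0 = 0.
Proof. by rewrite /box_cost eqxx. Qed.

Lemma box_cost_ge0 l (A : set 'rV[R]_l) : 0 <= box_cost A.
Proof.
rewrite /box_cost; case: ifP => // _; apply: le_ereal_inf_tmp => _ [ab [abP _] <-].
by rewrite lee_fin; apply: prodr_ge0 => i _; rewrite subr_ge0.
Qed.

HB.instance Definition _ (l : nat) :=
  isOuterMeasure.Build R 'rV[R]_l (lebesgue_rV (l := l))
    (@mu_ext0 _ (discrete_type 'rV[R]_l) R box_cost (box_cost0 l) (@box_cost_ge0 l))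
    (@mu_ext_ge0 _ (discrete_type 'rV[R]_l) R box_cost (@box_cost_ge0 l))
    (@le_mu_ext _ (discrete_type 'rV[R]_l) R box_cost)
    (@mu_ext_sigma_subadditive _ (discrete_type 'rV[R]_l) R box_cost
       (@box_cost_ge0 l)).

Definition lebesgue_outer (l : nat) : {outer_measure set 'rV[R]_l -> \bar R} :=
  lebesgue_rV.

(* R^l with the sigma-algebra of Lebesgue (i.e. Caratheodory) measurable sets *)
Definition lebesgue_space (l : nat) := caratheodory_type (lebesgue_outer l).
HB.instance Definition _ (l : nat) := Measurable.on (lebesgue_space l).

Definition lebesgue_measure_rV (l : nat) :
    {measure set (lebesgue_space l) -> \bar R} :=
  lebesgue_outer l : set (caratheodory_type (lebesgue_outer l)) -> \bar R.

(* s-dimensional Hausdorff measure on R^l, with the normalization that makes it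
   the s-dimensional Lebesgue measure on isometric copies of R^s; for s = 0 it
   is the counting measure. *)
Definition unit_ball_volume (s : nat) : R :=
  fine (lebesgue_rV [set x : 'rV[R]_s | (enorm x < 1)%R]).

Definition hausdorff_cost {l} (s : nat) (delta : R) (A : set 'rV[R]_l) : \bar R :=
  if A == set0 then 0 else
  if ediam A <= delta%:E
  then (unit_ball_volume s * (fine (ediam A) / 2) ^+ s)%R%:E else +oo.

Definition hausdorff {l} (s : nat) (A : set 'rV[R]_l) : \bar R :=
  ereal_sup [set @mu_ext _ (discrete_type 'rV[R]_l) R (hausdorff_cost s delta) A
    | delta in [set delta | (0 < delta)%R]].

End Measures.

Arguments lebesgue_space R l : clear implicits.
Arguments lebesgue_measure_rV R l : clear implicits.

Section Mesh.
Context {R : realType} {l : nat}.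

(* m(K) and m(sigma) *)
Definition vol (A : set 'rV[R]_l) : R := fine (lebesgue_rV A).
Definition area (A : set 'rV[R]_l) : R := fine (hausdorff l.-1 A).

Definition bounded_lipschitz_domain (Omega : set 'rV[R]_l) : Prop :=
  [/\ open Omega, bounded_set Omega & lipschitz_boundary Omega].

(* The orientation is required at almost every point of sigma only: at the
   points of sigma lying on another edge of K it may fail. *)
Definition outward_unit_normal (K sigma : set 'rV[R]_l) (n : 'rV[R]_l) : Prop :=
  [/\ enorm n = 1,
      forall y z, sigma y -> sigma z -> dotp n (y - z) = 0
    & hausdorff l.-1 (sigma `\` [set y | exists2 e, 0 < e &
        forall t, 0 < t < e -> K (y - t *: n) /\ ~ K (y + t *: n)]) = 0%E].

(* [bedges K] are the edges of K that lie on the boundary of the domain; the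
   edges between control volumes are the sets K|L, see [interface]. *)
Record mesh := Mesh {
  cv :> finType;
  cell : cv -> set 'rV[R]_l;
  center : cv -> 'rV[R]_l;
  bedges : cv -> set (set 'rV[R]_l);
  normal : cv -> set 'rV[R]_l -> 'rV[R]_l }.

Implicit Types (O : mesh).

Definition interface O (K L : O) : set 'rV[R]_l :=
  closure (cell K) `&` closure (cell L).

Definition neighbour O (K L : O) : Prop :=
  K != L /\ (0 < hausdorff l.-1 (interface K L))%E.

Definition edges O (K : O) : set (set 'rV[R]_l) :=
  [set interface K L | L in neighbour K] `|` bedges K.

Definition mesh_size O : R := \big[Num.max/0]_(K : O) fine (ediam (cell K)).

Definition transmissivity O (K L : O) : R :=
  area (interface K L) / enorm (center K - center L).

Record admissible_mesh (Omega : set 'rV[R]_l) (alpha : R) O : Prop := {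
  cell_sub : forall K : O, cell K `<=` Omega;
  cell_connected : forall K : O, connected (cell K);
  cell_polygonal : forall K : O, polygonal (cell K);
  cell_disjoint : forall K L : O, K != L -> cell K `&` cell L = set0;
  cell_cover : \bigcup_(K in [set: O]) closure (cell K) = closure Omega;
  interface_flat : forall K L : O, neighbour K L -> in_hyperplane (interface K L);
  bedges_finite : forall K : O, finite_set (bedges K);
  bedges_sub : forall (K : O) sigma, bedges K sigma ->
    sigma `<=` boundary (cell K) `&` boundary Omega;
  bedges_flat : forall (K : O) sigma, bedges K sigma -> in_hyperplane sigma;
  bedges_cover : forall K : O, hausdorff l.-1
    ((boundary (cell K) `&` boundary Omega) `\`
       \bigcup_(sigma in bedges K) sigma) = 0%E;
  normalP : forall (K : O) sigma, edges K sigma ->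
    outward_unit_normal (cell K) sigma (normal K sigma);
  center_in : forall K : O, cell K (center K);
  center_orthogonal : forall K L : O, neighbour K L -> forall y z,
    interface K L y -> interface K L z ->
    dotp (center L - center K) (y - z) = 0;
  alpha_gt0 : 0 < alpha;
  cell_vol : forall K : O, alpha * mesh_size O ^+ l <= vol (cell K);
  cell_perimeter : forall K : O,
    (hausdorff l.-1 (boundary (cell K)) <= (alpha^-1 * mesh_size O ^+ l.-1)%:E)%E }.

End Mesh.

Arguments mesh R l : clear implicits.

Section Problem.
Context {R : realType} {l : nat}.

Record problem_data (umax uc : R) (f : R -> 'rV[R]_l) (phi : R -> R) : Prop := {
  umax_gt0 : 0 < umax;
  f_continuous : {within `[0, umax], continuous f};
  f_at0 : f 0 = 0;
  f_at_umax : f umax = 0;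
  phi_nondecreasing : {in `[0, umax] &, {homo phi : a b / a <= b}};
  phi_lipschitz : exists k : R, forall a b, a \in `[0, umax] -> b \in `[0, umax] ->
    `|phi a - phi b| <= k * `|a - b|;
  uc_in : uc \in `[0, umax];
  phi_eq0 : forall a, a \in `[0, uc] -> phi a = 0;
  phi_increasing : {in `[uc, umax] &, {homo phi : a b / a < b}};
  non_degenerate : forall xi : 'rV[R]_l, xi != 0 ->
    forall a b, 0 <= a -> a < b -> b <= uc ->
    ~ exists p q, forall lambda, lambda \in `[a, b] ->
        dotp xi (f lambda) = p * lambda + q }.

(* [F K sigma] is the flux through the edge sigma of K, oriented outward to K.
   It is a function on R^2, but the four properties bear on [0, umax] only. *)
Record numerical_flux (umax : R) (f : R -> 'rV[R]_l) (M : R) (O : mesh R l)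
    (F : O -> set 'rV[R]_l -> R -> R -> R) : Prop := {
  flux_monotone : forall (K : O) sigma, edges K sigma ->
    forall a a' b b', a \in `[0, umax] -> a' \in `[0, umax] ->
      b \in `[0, umax] -> b' \in `[0, umax] ->
      a <= a' -> b' <= b -> F K sigma a b <= F K sigma a' b';
  flux_conservative : forall K L : O, neighbour K L ->
    forall a b, a \in `[0, umax] -> b \in `[0, umax] ->
      F K (interface K L) a b = - F L (interface L K) b a;
  flux_regular : forall (K : O) sigma, edges K sigma ->
    forall a a' b b', a \in `[0, umax] -> a' \in `[0, umax] ->
      b \in `[0, umax] -> b' \in `[0, umax] ->
      `|F K sigma a b - F K sigma a' b'|
        <= area sigma * M * (`|a - a'| + `|b - b'|);
  flux_consistent : forall (K : O) sigma, edges K sigma ->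
    forall s, s \in `[0, umax] ->
      F K sigma s s = area sigma * dotp (f s) (normal K sigma) }.

(* The unknowns of the scheme range over R, so that phi and the fluxes through
   the edges K|L have to be given outside [0, umax] too.  All that is asked there
   is that the order and the conservativity be kept; nothing is asked on the
   regularity or the consistency.  Some requirement is necessary: for values that
   are arbitrary outside [0, umax], a solution of the scheme may leave [0, umax].
   [clip_problem] below gives the constant extension, always available. *)
Record order_preserving_extension (phi : R -> R) (O : mesh R l)
    (F : O -> set 'rV[R]_l -> R -> R -> R) : Prop := {
  ext_phi : {homo phi : a b / a <= b};
  ext_monotone : forall K L : O, neighbour K L -> forall a a' b b',
    a <= a' -> b' <= b -> F K (interface K L) a b <= F K (interface K L) a' b';
  ext_conservative : forall K L : O, neighbour K L -> forall a b,
    F K (interface K L) a b = - F L (interface L K) b a }.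

Definition initial_datum (Omega : set 'rV[R]_l) (umax : R)
    (u0 : 'rV[R]_l -> R) : Prop :=
  measurable_fun (Omega : set (lebesgue_space R l)) u0 /\
  {ae lebesgue_measure_rV R l,
    forall x, Omega x -> 0 <= u0 x <= umax}.

Definition mean_value (u0 : 'rV[R]_l -> R) (K : set 'rV[R]_l) : R :=
  (vol K)^-1 * \int[lebesgue_measure_rV R l]_(x in K) u0 x.

(* [u n K] stands for u_K^n. *)
Definition scheme_solution (phi : R -> R) (u0 : 'rV[R]_l -> R) (O : mesh R l)
    (F : O -> set 'rV[R]_l -> R -> R -> R) (dt : R) (u : nat -> O -> R) : Prop :=
  (forall K, u 0%N K = mean_value u0 (cell K)) /\
  (forall n K,
     vol (cell K) * ((u n.+1 K - u n K) / dt)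
     + \sum_(L : O | `[< neighbour K L >])
         F K (interface K L) (u n.+1 K) (u n.+1 L)
     - \sum_(L : O | `[< neighbour K L >])
         transmissivity K L * (phi (u n.+1 L) - phi (u n.+1 K)) = 0).

(* w is the function u_{O,dt}, on (0,T) x Omega, made of the values u. *)
Definition approximate_solution (T : R) (phi : R -> R) (u0 : 'rV[R]_l -> R)
    (O : mesh R l) (F : O -> set 'rV[R]_l -> R -> R -> R) (dt : R)
    (u : nat -> O -> R) (w : R -> 'rV[R]_l -> R) : Prop :=
  scheme_solution phi u0 F dt u /\
  forall n K t x, 0 < t < T -> n%:R * dt < t <= n.+1%:R * dt ->
    cell K x -> w t x = u n.+1 K.

Definition clip (umax s : R) : R := Num.max 0 (Num.min s umax).

Lemma clip_in umax s : 0 <= umax -> clip umax s \in `[0, umax].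
Proof.
by move=> u0; rewrite in_itv /= /clip le_max lexx /= ge_max u0 /= ge_min lexx orbT.
Qed.

Lemma clip_homo umax : {homo clip umax : a b / a <= b}.
Proof.
move=> a b ab; rewrite /clip ge_max le_max lexx /= le_max; apply/orP; right.
by rewrite le_min !ge_min ab lexx orbT.
Qed.

Lemma clip_id umax s : s \in `[0, umax] -> clip umax s = s.
Proof.
by rewrite in_itv => /andP[s0 su]; rewrite /clip (min_idPl su) (max_idPr s0).
Qed.

Lemma clip_problem umax uc f phi M (O : mesh R l) F :
  problem_data umax uc f phi -> numerical_flux umax f M F ->
  order_preserving_extension (phi \o clip umax)
    (fun (K : O) sigma a b => F K sigma (clip umax a) (clip umax b)).
Proof.
move=> [/ltW u0 _ _ _ hphi _ _ _ _ _] [mono cons _ _]; split.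
- by move=> a b ab; apply: hphi; rewrite ?clip_in ?clip_homo.
- move=> K L KL a a' b b' aa bb; apply: mono; rewrite ?clip_in ?clip_homo //.
  by left; exists L.
- by move=> K L KL a b; apply: cons; rewrite ?clip_in.
Qed.

End Problem.

(* Main.v *)
Require Import Defs.
From mathcomp Require Import all_boot all_order all_algebra.
From mathcomp Require Import all_classical all_reals all_analysis measurable_realfun.
From mathcomp Require Import ring lra.

Import Order.TTheory GRing.Theory Num.Theory.
Local Open Scope classical_set_scope.
Local Open Scope ring_scope.

(** This is a maximum principle for an implicit monotone scheme, by induction on
    the time level.

    At level 0 the values are means of a function lying in [0, umax] almost
    everywhere ([mean_value_in]).

    For the upper bound at level n+1, sum the scheme over the set A of the
    control volumes where the new value exceeds umax.  Across an edge between
    two cells of A the contributions cancel, by conservativity and by the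
    symmetry of the transmissivities.  Across an edge K|L with K in A and L
    outside A one has u_L <= umax < u_K, so that monotonicity gives
    F_(K,L)(u_K, u_L) >= F_(K,L)(umax, umax), which is 0 because f(umax) = 0;
    the diffusive term has the same sign, as phi is nondecreasing.  Hence the
    net outflow from A is nonnegative, and the mass in A does not increase.  But
    on A the new value is above umax and the old one is not, so the mass
    increases strictly unless A is empty ([outflow_ge0], [implicit_step_le]).
    Taking the whole set A, rather than one cell where the maximum is attained,
    makes (umax, umax) the only point with which the fluxes are compared.

    The lower bound is the same argument applied to the opposite unknowns and
    the opposite fluxes, with F_(K,L)(0, 0) = 0 since f(0) = 0. *)

Section IntegralOverAnySet.
Local Open Scope ereal_scope.
Import HBNNSimple.

(** The integral over D is a supremum over measurable simple functions that
    vanish outside D, so that D itself may fail to be measurable: only the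
    measurable sets inside D matter, and v bounds their measure.  For a control
    volume, v is its outer measure. *)
Lemma ge0_integral_le_cst (d : measure_display) (T : measurableType d)
    (R : realType) (mu : {measure set T -> \bar R}) (D : set T)
    (f : T -> \bar R) (c : R) (v : \bar R) :
  (0 <= c)%R -> (forall x, D x -> 0 <= f x) ->
  {ae mu, forall x, D x -> f x <= c%:E} ->
  (forall B, measurable B -> B `<=` D -> mu B <= v) ->
  \int[mu]_(x in D) f x <= c%:E * v.
Proof.
move=> c0 f0 fc Dv; rewrite ge0_integralE//.
apply: ge_ereal_sup => _ [h hf <-].
(* h is supported in B, and B lies in D because h is below the extension of f
   by zero *)
pose B := [set x | (0 < h x)%R].
have mB : measurable B.
  have -> : B = h @^-1` `]0%R, +oo[%classic.
    by apply/seteqP; split=> x; rewrite /B /= in_itv /= andbT.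
  exact: measurable_funPTI.
have BD : B `<=` D.
  move=> x; rewrite /B /= => hx; apply: contrapT => nDx.
  by have := hf x; rewrite /patch memNset// lee_fin leNgt hx.
rewrite -integralT_nnsfun.
apply: (@le_trans _ _ (\int[mu]_(x in B) cst c%:E x)); last first.
  by rewrite integral_cst//; apply: lee_wpmul2l; rewrite ?lee_fin ?Dv.
rewrite [leRHS]integral_mkcond.
apply: ae_ge0_le_integral => //.
- by move=> x _; rewrite lee_fin.
- by apply/measurable_EFinP; exact: measurable_funP.
- by move=> x _; rewrite /patch; case: ifP; rewrite ?lee_fin.
- by apply/(measurable_restrictT _ _).1 => //; exact: measurable_cst.
near=> x => _.
have fcx : D x -> f x <= c%:E by near: x.
have := hf x; rewrite /patch.
have [Bx|nBx] := pselect (B x).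
  by rewrite !mem_set//; [move=> /le_trans; apply; exact/fcx/BD|exact: BD].
by move=> _; rewrite memNset// lee_fin leNgt; exact/negP.
Unshelve. all: by end_near. Qed.

End IntegralOverAnySet.

(** The positive part of u0 is almost everywhere at most umax and the negative
    part at most 0; both integrals over K are then bounded by
    [ge0_integral_le_cst], because the Lebesgue outer measure is monotone and
    therefore vol K dominates the measurable sets inside K. *)
Lemma mean_value_in {R : realType} {l : nat} {Omega : set 'rV[R]_l}
    {umax : R} {u0 : 'rV[R]_l -> R} {K : set 'rV[R]_l} :
  initial_datum Omega umax u0 -> K `<=` Omega -> 0 <= umax -> 0 < vol K ->
  0 <= mean_value u0 K <= umax.
Proof.
move=> [_ u0P] KO um0 volK.
(* an infinite outer measure would give vol K = fine +oo = 0 *)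
have Kfin : lebesgue_rV K = (vol K)%:E.
  move: volK; rewrite /vol; by case: (lebesgue_rV K) => //=; rewrite ltxx.
have leK (B : set (lebesgue_space R l)) : measurable B -> B `<=` K ->
    (lebesgue_measure_rV R l B <= (vol K)%:E)%E.
  by move=> _ BK; rewrite -Kfin; exact: (le_outer_measure (lebesgue_outer l)).
have pos_le : (\int[lebesgue_measure_rV R l]_(x in K)
    ((EFin \o u0)^\+ x) <= (umax * vol K)%:E)%E.
  rewrite EFinM; apply: ge0_integral_le_cst => //.
  case: u0P => N [mN N0 NP]; exists N; split=> //; apply: subset_trans NP => x.
  by apply: contra_not => xP /KO/xP/andP[_ ux];
    rewrite funeposE /= ge_max !lee_fin ux um0.
have neg0 : (\int[lebesgue_measure_rV R l]_(x in K)
    ((EFin \o u0)^\- x) = 0)%E.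
  apply/eqP; rewrite eq_le integral_ge0// andbT.
  rewrite -(mul0e (vol K)%:E).
  apply: ge0_integral_le_cst => //.
  case: u0P => N [mN N0 NP]; exists N; split=> //; apply: subset_trans NP => x.
  by apply: contra_not => xP /KO/xP/andP[ux _];
    rewrite funenegE /= ge_max !lee_fin oppr_le0 ux lexx.
have int_in : 0 <= \int[lebesgue_measure_rV R l]_(x in K) u0 x <= umax * vol K.
  rewrite /Rintegral (integralE (lebesgue_measure_rV R l)) neg0 sube0.
  have ge0 : (0 <= \int[lebesgue_measure_rV R l]_(x in K) ((EFin \o u0)^\+ x))%E.
    exact: integral_ge0.
  move: ge0 pos_le; case: (integral _ _ _) => //= r.
  by rewrite !lee_fin => -> ->.
case/andP: int_in => i0 iu.
rewrite /mean_value mulr_ge0 ?invr_ge0 ?(ltW volK)//=.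
by rewrite mulrC ler_pdivrMr.
Qed.

(** The exchanges inside A form an antisymmetric double sum, which vanishes;
    only the edges leaving A remain. *)
Lemma outflow_ge0 {R : realDomainType} {I : finType} {nb : rel I} {A : pred I}
    {G : I -> I -> R} :
  symmetric nb -> (forall K L, nb K L -> G K L = - G L K) ->
  (forall K L, nb K L -> A K -> ~~ A L -> 0 <= G K L) ->
  0 <= \sum_(K | A K) \sum_(L | nb K L) G K L.
Proof.
move=> nbC GN Gout.
pose S := \sum_(K | A K) \sum_(L | A L && nb K L) G K L.
have SN : S = - S.
  rewrite {1}/S (exchange_big_dep A)//=; last by move=> i j _ /andP[].
  rewrite /S -sumrN; apply: eq_bigr => L AL; rewrite -sumrN.
  by apply: eq_big => [K|K /andP[AK /andP[_ KL]]];
    [rewrite AL nbC | exact: GN].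
have S0 : S = 0 by clearbody S; lra.
rewrite (eq_bigr (fun K => \sum_(L | A L && nb K L) G K L
                           + \sum_(L | ~~ A L && nb K L) G K L)); last first.
  move=> K _; rewrite (bigID A)/=.
  by congr (_ + _); apply: eq_bigl => L; rewrite andbC.
rewrite big_split/= -/S S0 add0r.
apply: sumr_ge0 => K AK; apply: sumr_ge0 => L /andP[AL KL]; exact: Gout.
Qed.

(** Summing the balance over the cells with v > c opposes a nonnegative outflow
    to a strict gain of mass.  Here G gathers the convective and the diffusive
    exchanges, so that it is the only thing whose sign has to be known. *)
Lemma implicit_step_le {R : realFieldType} {I : finType} {nb : rel I}
    {m : I -> R} {dt c : R} {u v : I -> R} {G : I -> I -> R} :
  symmetric nb -> (forall K L, nb K L -> G K L = - G L K) ->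
  0 < dt -> (forall K, 0 < m K) ->
  (forall K, m K * ((v K - u K) / dt) + \sum_(L | nb K L) G K L = 0) ->
  (forall K L, nb K L -> v L <= c -> c < v K -> 0 <= G K L) ->
  (forall K, u K <= c) -> forall K, v K <= c.
Proof.
move=> nbC GN dt0 m0 bal Gout uc K0; rewrite leNgt; apply/negP => cK0.
pose A K := c < v K.
have out : 0 <= \sum_(K | A K) \sum_(L | nb K L) G K L.
  apply: outflow_ge0 => // K L KL AK; rewrite -leNgt => AL; exact: Gout.
have mass K : A K -> 0 < m K * ((v K - u K) / dt).
  by move=> AK; rewrite mulr_gt0// divr_gt0// subr_gt0 (le_lt_trans (uc K)).
have : 0 < \sum_(K | A K) m K * ((v K - u K) / dt).
  rewrite (bigD1 K0)//=; apply: ltr_pwDl; first exact: mass.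
  by apply: sumr_ge0 => K /andP[/mass/ltW].
rewrite ltNge => /negP; apply.
rewrite -oppr_ge0 -sumrN; apply: etrans out; congr (0 <= _); apply: eq_bigr => K _.
by apply/esym/eqP; rewrite -addr_eq0 addrC bal.
Qed.

Lemma interfaceC {R : realType} {l : nat} {O : mesh R l} (K L : O) :
  interface K L = interface L K.
Proof. exact: setIC. Qed.

Lemma neighbourC {R : realType} {l : nat} {O : mesh R l} (K L : O) :
  neighbour K L -> neighbour L K.
Proof. by rewrite /neighbour eq_sym interfaceC. Qed.

Lemma dotpNN {R : realType} {l : nat} (x : 'rV[R]_l) :
  dotp (- x) (- x) = dotp x x.
Proof. by apply: eq_bigr => i _; rewrite !mxE mulrNN. Qed.

Lemma transmissivityC {R : realType} {l : nat} {O : mesh R l} (K L : O) :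
  transmissivity K L = transmissivity L K.
Proof.
by rewrite /transmissivity interfaceC /enorm -dotpNN opprB.
Qed.

Lemma transmissivity_ge0 {R : realType} {l : nat} {O : mesh R l} (K L : O) :
  neighbour K L -> 0 <= transmissivity K L.
Proof.
move=> [_ KL]; rewrite divr_ge0 ?sqrtr_ge0//.
by rewrite fine_ge0// ltW.
Qed.

Lemma flux_at_zero_of_f {R : realType} {l : nat} {umax M s : R}
    {f : R -> 'rV[R]_l} {O : mesh R l}
    {F : O -> set 'rV[R]_l -> R -> R -> R} {K L : O} :
  numerical_flux umax f M F -> s \in `[0, umax] -> f s = 0 ->
  neighbour K L -> F K (interface K L) s s = 0.
Proof.
move=> [_ _ _ cons] sI fs0 KL; rewrite cons//; last by left; exists L.
by rewrite fs0 /dotp big1 ?mulr0// => i _; rewrite mxE mul0r.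
Qed.

(** The inverse of 0 is 0, so that for a mesh size 0 the bound on the number of
    control volumes reads #|O| <= 0, which the presence of K contradicts.  As l
    is at least 1, the power 0 ^+ l is indeed 0. *)
Lemma mesh_size_gt0 {R : realType} {l : nat} {O : mesh R l} {c : R} (K : O) :
  (1 <= l)%N -> #|O|%:R <= c * mesh_size O ^- l -> 0 < mesh_size O.
Proof.
move=> l1 card; have : 0 <= mesh_size O by exact: bigmax_ge_id.
rewrite le_eqVlt => /orP[/eqP h0|//]; exfalso; move: card.
by rewrite -h0 expr0n gtn_eqF//= invr0 mulr0 lern0 => /eqP/card0_eq/(_ K).
Qed.

Theorem proposition4p1 (R : realType) (l : nat) (Omega : set 'rV[R]_l)
  (T umax uc : R) (f : R -> 'rV[R]_l) (phi : R -> R) (u0 : 'rV[R]_l -> R)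
  (O : mesh R l) (alpha M : R) (F : O -> set 'rV[R]_l -> R -> R -> R)
  (dt : R) (u : nat -> O -> R) (w : R -> 'rV[R]_l -> R)
  (hl : (1 <= l)%N)
  (hOmega : bounded_lipschitz_domain Omega)
  (hT : 0 < T)
  (hdata : problem_data umax uc f phi)
  (hmesh : admissible_mesh Omega alpha O)
  (hcard : #|O|%:R <= vol Omega / alpha * mesh_size O ^- l)
  (hF : numerical_flux umax f M F)
  (hext : order_preserving_extension phi F)
  (hu0 : initial_datum Omega umax u0)
  (hdt : 0 < dt)
  (hu : approximate_solution T phi u0 F dt u w) :
  forall (n : nat) (K : O), 0 <= u n K <= umax.
Proof.
case: hu => [[u_init u_step] _]; case: hext => phiM FM FC.
have um0 : 0 <= umax by exact: ltW (umax_gt0 hdata).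
have zI : 0 \in `[0, umax] by rewrite in_itv/= lexx.
have uI : umax \in `[0, umax] by rewrite in_itv/= lexx um0.
have vol0 (K : O) : 0 < vol (cell K).
  apply: lt_le_trans (cell_vol hmesh K).
  by rewrite mulr_gt0 ?(alpha_gt0 hmesh)// exprn_gt0// (mesh_size_gt0 K hl hcard).
pose nb (K L : O) := `[< neighbour K L >].
(* the total numerical flux from K to L, convection minus diffusion *)
pose G n (K L : O) := F K (interface K L) (u n.+1 K) (u n.+1 L)
  - transmissivity K L * (phi (u n.+1 L) - phi (u n.+1 K)).
have nbC : symmetric nb.
  by move=> K L; apply/asboolP/asboolP => /neighbourC.
have GN n K L : nb K L -> G n K L = - G n L K.
  by move=> /asboolP KL; rewrite /G FC// (transmissivityC L); ring.
have bal n K : vol (cell K) * ((u n.+1 K - u n K) / dt)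
    + \sum_(L | nb K L) G n K L = 0.
  by rewrite -[RHS](u_step n K) /G sumrB addrA.
elim=> [|n IH] K; first
  by rewrite u_init (mean_value_in hu0)//; exact: cell_sub hmesh _.
apply/andP; split.
- rewrite -lerN2 oppr0.
  apply: (@implicit_step_le _ O nb (fun K => vol (cell K)) dt 0 (fun K => - u n K)
    (fun K => - u n.+1 K) (fun K L => - G n K L)) => //.
  + by move=> {}K L KL; rewrite GN.
  + by move=> {}K; rewrite sumrN -opprD mulNr mulrN -opprD bal oppr0.
  + move=> {}K L /asboolP KL; rewrite oppr_le0 oppr_gt0 => uL uK.
    rewrite /G oppr_ge0 subr_le0 (@le_trans _ _ 0)//.
      by rewrite -(flux_at_zero_of_f hF zI (f_at0 hdata) KL) FM// ltW.
    rewrite mulr_ge0 ?transmissivity_ge0// subr_ge0 phiM//.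
    exact: le_trans (ltW uK) uL.
  + by move=> {}K; rewrite oppr_le0; case/andP: (IH K).
- move: K; apply: (implicit_step_le nbC (GN n) hdt vol0 (bal n)).
  + move=> K L /asboolP KL uL uK.
    rewrite /G subr_ge0 (@le_trans _ _ 0)//.
      rewrite mulr_ge0_le0 ?transmissivity_ge0// subr_le0 phiM//.
      exact: le_trans uL (ltW uK).
    by rewrite -(flux_at_zero_of_f hF uI (f_at_umax hdata) KL) FM// ltW.
  + by move=> K; case/andP: (IH K).
Qed.
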